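(* Let $q\ge2$ be an integer and $p\in(0,\frac{q-1}{q})$. There are constants $c_0>0$ and $\varepsilon_0>0$ depending only on $p,q$ such that for every $\varepsilon$ with $0<\varepsilon<1-h_q(p)$ there exist $\gamma=\gamma_{p,q,\varepsilon}>0$, with $\gamma\le\exp(-c_0/\varepsilon)$ whenever $\varepsilon\le\varepsilon_0$ (that is, $\gamma=\exp(-\Omega_{p,q}(1/\varepsilon))$), an integer $n_{p,q,\varepsilon}$ and a constant $\delta=\delta_{p,q,\varepsilon}>0$ such that the following holds for all $n\ge n_{p,q,\varepsilon}$: a random code $\mathcal C\subseteq[q]^n$ of rate $R=1-h_q(p)-\varepsilon$ is, with probability at least $1-\exp(-\delta n)$, not $\bigl(p,\frac{1-\gamma}{\varepsilon}-1\bigr)$-list decodable.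
   Context: The $q$-ary entropy function is $h_q(x)=x\log_q(q-1)-x\log_q x-(1-x)\log_q(1-x)$. The Hamming distance $\Delta(x,y)$ of $x,y\in[q]^n$ is the number of coordinates in which they differ; the Hamming ball of radius $s$ around $y$ is $\{x:\Delta(x,y)\le s\}$. A code of rate $R$ has $q^{Rn}$ codewords (rounded down to an integer). A random code of rate $R$ is a random map $\mathcal C$ from a set of $q^{Rn}$ messages to $[q]^n$, the images of the messages being independent and uniformly distributed in $[q]^n$. For a real number $L$, the code is $(p,L)$-list decodable if for every $y\in[q]^n$ the Hamming ball of radius $pn$ around $y$ contains at most $L$ codewords (counted by messages $m$ with $\mathcal C(m)$ in the ball). *)

(* Defs.v *)
From HB Require Import structures.
From mathcomp Require Import all_boot all_order all_algebra.
From mathcomp Require Import all_classical all_reals all_analysis.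

Set Implicit Arguments.
Unset Strict Implicit.
Unset Printing Implicit Defensive.

Import Order.TTheory GRing.Theory Num.Theory.

Local Open Scope ring_scope.

Definition logq {R : realType} (q : nat) (x : R) : R := ln x / ln q%:R.

Definition entropy {R : realType} (q : nat) (x : R) : R :=
  x * logq q (q%:R - 1) - x * logq q x - (1 - x) * logq q (1 - x).

Definition word (q n : nat) := {ffun 'I_n -> 'I_q}.

Definition hamming_dist {q n : nat} (x y : word q n) : nat :=
  #|[pred i | x i != y i]|.

Definition hamming_ball {R : realType} {q n : nat} (y : word q n) (s : R) :
    pred (word q n) :=
  [pred x | (hamming_dist x y)%:R <= s].

(* Codewords are counted by messages, that is, with multiplicity. *)
Definition list_decodable {R : realType} {q n M : nat} (p L : R)
    (C : 'I_M -> word q n) : Prop :=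
  forall y : word q n,
    #|[pred m | C m \in hamming_ball y (p * n%:R)]|%:R <= L.

Definition num_messages {R : realType} (q n : nat) (rate : R) : nat :=
  Num.truncn (q%:R `^ (rate * n%:R)).

(* Mutual independence of finitely many variables with values in a type U all
   of whose subsets count as measurable (below, U is finite). *)
Definition mutually_independent {R : realType} {d : measure_display}
    {T : measurableType d} {I : finType} {U : Type} (P : probability T R)
    (X : I -> T -> U) : Prop :=
  forall (J : {set I}) (A : I -> set U),
    P (\bigcap_(i in [set` J]) (X i @^-1` A i))%classic =
    (\prod_(i in J) P (X i @^-1` A i)%classic)%E.

Record random_code {R : realType} {d : measure_display}
    {T : measurableType d} {q n M : nat} (P : probability T R)
    (C : T -> 'I_M -> word q n) : Prop := RandomCode {
  random_code_measurable : forall m (c : word q n),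
    measurable [set w | C w m = c]%classic;
  random_code_uniform : forall m (c : word q n),
    P [set w | C w m = c]%classic = ((q%:R ^+ n)^-1)%:E;
  random_code_independent : mutually_independent P (fun m w => C w m)
}.

(* Main.v *)
Require Import Defs.
From HB Require Import structures.
From mathcomp Require Import all_boot all_order all_algebra.
From mathcomp Require Import all_classical all_reals all_analysis.
From mathcomp Require Import ring lra zify.

Set Implicit Arguments.
Unset Strict Implicit.
Unset Printing Implicit Defensive.

Import Order.TTheory GRing.Theory Num.Theory.

Local Open Scope ring_scope.

(** The proof is a second moment argument.  Let [k] be the least integer above
    the list size [L = (1 - gamma) / eps - 1], so that [k * eps <= 1 - gamma],
    and cut the messages into [k] blocks of [m] messages, [m] of order
    [q ^ (rate * n) / k].  If a ball contains a codeword of every block, its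
    centre defeats [L]-list decoding.  Let [W] be the average over all centres
    [y] of the product over the blocks of the proportion of the codewords of
    that block that lie in the ball around [y].  It suffices that [W] is
    positive with probability exponentially close to 1.

    The blocks are independent and each behaves in the same way, so both
    moments of [W] are averages of [k]-th powers.  If [mu] is the density of a
    ball and [nu y y'] the density of the intersection of two balls, Chebyshev's
    inequality bounds the probability of [W = 0] by the average over pairs of
    centres of [(1 + u) ^ k - 1], where [u = nu y y' / (m * mu ^ 2)]
    ([avg_no_common_cover]).  As this is at most [2 ^ k * (u + u ^ k)]
    ([exprD1_sub1_le]), only the two extreme powers matter.

    The average of [u] is [1 / m], which is exponentially small since the rate
    is positive.  For the average of [u ^ k], write [Q = q ^ h(p)]; two facts
    on balls are used ([hamming_ball_geometry]).  A ball has at least [Q ^ n]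
    points up to a polynomial factor, because the binomial distribution of
    parameter [p] has a mode next to [p * n].  Two balls whose centres are at
    distance [a] meet in at most [Q ^ n * r ^ a] points, for a constant [r < 1],
    by an exponential moment bound that treats each coordinate separately.  Up
    to polynomial factors [u] is then at most [q ^ (eps * n) * r ^ a], and
    averaging the [k]-th power over the second centre gives
    [q ^ (k * eps * n - n) * (1 + (q - 1) * r ^ k) ^ n].  Since
    [k * eps <= 1 - gamma], this decays exponentially as soon as
    [(q - 1) * r ^ k < gamma * ln q].  With [k] close to [1 / eps], this leaves
    room for a [gamma] that is exponentially small in [1 / eps]
    ([list_size_choice]). *)

(** * Averages over finite types and the second moment method *)

Definition avg {R : realFieldType} {X : finType} (f : X -> R) : R :=
  (\sum_x f x) / #|X|%:R.

Lemma eq_avg (R : realFieldType) (X : finType) (f g : X -> R) :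
  f =1 g -> avg f = avg g.
Proof. by move=> fg; rewrite /avg; under eq_bigr do rewrite fg. Qed.

Lemma ler_avg (R : realFieldType) (X : finType) (f g : X -> R) :
  (forall x, f x <= g x) -> avg f <= avg g.
Proof. by move=> fg; rewrite ler_wpM2r ?invr_ge0// ler_sum. Qed.

Lemma avgD (R : realFieldType) (X : finType) (f g : X -> R) :
  avg (fun x => f x + g x) = avg f + avg g.
Proof. by rewrite /avg big_split mulrDl. Qed.

Lemma avgZ (R : realFieldType) (X : finType) (a : R) (f : X -> R) :
  avg (fun x => a * f x) = a * avg f.
Proof. by rewrite /avg -mulr_sumr mulrA. Qed.

Lemma avg_cst (R : realFieldType) (X : finType) (a : R) :
  (0 < #|X|)%N -> avg (fun _ : X => a) = a.
Proof.
move=> X0; rewrite /avg sumr_const -[a *+ _]mulr_natr mulfK// pnatr_eq0 -lt0n//.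
Qed.

Lemma avg_ge0 (R : realFieldType) (X : finType) (f : X -> R) :
  (forall x, 0 <= f x) -> 0 <= avg f.
Proof. by move=> f0; rewrite divr_ge0// sumr_ge0. Qed.

Lemma exchange_avg (R : realFieldType) (X Y : finType) (f : X -> Y -> R) :
  avg (fun x => avg (f x)) = avg (fun y => avg (f^~ y)).
Proof.
by rewrite /avg -!mulr_suml exchange_big/= !mulr_suml; under eq_bigr do
  rewrite mulrAC.
Qed.

Lemma avgM (R : realFieldType) (X Y : finType) (f : X -> R) (g : Y -> R) :
  avg f * avg g = avg (fun x => avg (fun y => f x * g y)).
Proof.
by rewrite mulrC -avgZ; apply: eq_avg => x; rewrite avgZ mulrC.
Qed.

(** Independence of the coordinates of a uniform finite function. *)
Lemma avg_ffun_prod (R : realFieldType) (I X : finType) (F : I -> X -> R) :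
  avg (fun c : {ffun I -> X} => \prod_i F i (c i)) = \prod_i avg (F i).
Proof.
rewrite /avg -(bigA_distr_bigA F) card_ffun natrX big_split/=; congr (_ * _).
by rewrite prodr_const -exprVn.
Qed.

Lemma avg_ffun_eval (R : realFieldType) (I X : finType) (i : I) (a : X -> R) :
  (0 < #|X|)%N -> avg (fun c : {ffun I -> X} => a (c i)) = avg a.
Proof.
move=> X0; pose F j x := if j == i then a x else 1.
rewrite (@eq_avg _ _ _ (fun c : {ffun I -> X} => \prod_j F j (c j))); last first.
  by move=> c; rewrite -big_mkcond big_pred1_eq.
rewrite avg_ffun_prod (bigD1 i)//= {1}/F eqxx big1 ?mulr1// => j /negbTE ji.
by rewrite /F ji avg_cst.
Qed.

Lemma avg_ffun_eval2 (R : realFieldType) (I X : finType) (i j : I)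
    (a b : X -> R) : (0 < #|X|)%N -> i != j ->
  avg (fun c : {ffun I -> X} => a (c i) * b (c j)) = avg a * avg b.
Proof.
move=> X0 ij.
pose F l x := if l == i then a x else if l == j then b x else 1.
rewrite (@eq_avg _ _ _ (fun c : {ffun I -> X} => \prod_l F l (c l))); last first.
  move=> c; rewrite (bigD1 i)//= {1}/F eqxx (bigD1 j) 1?eq_sym//=.
  rewrite {1}/F eqxx eq_sym (negbTE ij) big1 ?mulr1// => l /andP[/negbTE li /negbTE lj].
  by rewrite /F li lj.
rewrite avg_ffun_prod (bigD1 i)//= {1}/F eqxx (bigD1 j) 1?eq_sym//=.
rewrite {1}/F eqxx eq_sym (negbTE ij) big1 ?mulr1// => l /andP[/negbTE li /negbTE lj].
by rewrite /F li lj avg_cst.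
Qed.

(** Chebyshev's inequality: on the zeros of [W] the normalized square deviation
    [(W x / avg W - 1) ^+ 2] is 1, and its average is the right-hand side. *)
Lemma second_moment_vanish (R : realFieldType) (X : finType) (W : X -> R) :
  (0 < #|X|)%N -> 0 < avg W ->
  avg (fun x => (W x == 0)%:R) <= avg (fun x => W x ^+ 2) / avg W ^+ 2 - 1.
Proof.
move=> X0 W0; set e := avg W in W0 *.
have e20 : 0 < e ^+ 2 by rewrite exprn_gt0.
have -> : avg (fun x => W x ^+ 2) / e ^+ 2 - 1 =
    avg (fun x => (e ^+ 2)^-1 * W x ^+ 2 + (- 2 * e^-1 * W x + 1)).
  rewrite !avgD !avgZ avg_cst// -/e; field; exact: lt0r_neq0.
apply: ler_avg => x; have [->|_] := eqVneq (W x) 0.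
  by rewrite expr0n/= !mulr0 !add0r.
have -> : (e ^+ 2)^-1 * W x ^+ 2 + (- 2 * e^-1 * W x + 1) = (W x / e - 1) ^+ 2.
  by field; exact: lt0r_neq0.
exact: sqr_ge0.
Qed.

(** Off the diagonal [i != j] the two factors are independent; the diagonal has
    weight [1 / m] and contributes the second term. *)
Lemma avg_block_product (R : realFieldType) (X : finType) (m : nat) (a b : X -> R) :
  (0 < #|X|)%N -> (0 < m)%N -> (forall x, 0 <= a x) -> (forall x, 0 <= b x) ->
  avg (fun d : {ffun 'I_m -> X} =>
         avg (fun i => a (d i)) * avg (fun i => b (d i)))
  <= avg a * avg b + avg (fun x => a x * b x) / m%:R.
Proof.
move=> X0 m0 a0 b0.
rewrite (eq_avg (fun d : {ffun 'I_m -> X} => avgM (fun i => a (d i)) (fun i => b (d i)))).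
rewrite exchange_avg.
rewrite -[leRHS](@avg_cst _ 'I_m) ?card_ord//; apply: ler_avg => i.
rewrite exchange_avg.
have -> : avg a * avg b + avg (fun x => a x * b x) / m%:R =
   avg (fun j : 'I_m => avg a * avg b + (j == i)%:R * avg (fun x => a x * b x)).
  rewrite avgD avg_cst ?card_ord//; congr (_ + _).
  rewrite {2}/avg card_ord (bigD1 i)//= eqxx mul1r big1 ?addr0// => j.
  by move=> /negbTE ->; rewrite mul0r.
apply: ler_avg => j; have [->|ji] := eqVneq j i.
  by rewrite (avg_ffun_eval i (fun x => a x * b x))// mul1r lerDr mulr_ge0// avg_ge0.
by rewrite avg_ffun_eval2 1?eq_sym// mul0r addr0.
Qed.

Lemma avg_prod_ffun_exchange (R : realFieldType) (Y X : finType) (k : nat)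
    (F : Y -> X -> R) :
  avg (fun c : {ffun 'I_k -> X} => avg (fun y => \prod_j F y (c j))) =
  avg (fun y => avg (F y) ^+ k).
Proof.
rewrite exchange_avg; apply: eq_avg => y.
by rewrite (avg_ffun_prod (fun=> F y)) prodr_const card_ord.
Qed.

(** Second moment bound for the event that no [y] has, in every block [c j], a
    point in [B y].  The density [mu] of [B y] must not depend on [y], so that
    the mean of the counting variable is exactly [mu ^+ k]. *)
Lemma avg_no_common_cover (R : realFieldType) (X Y : finType) (B : Y -> pred X)
    (k m : nat) (mu : R) :
  (0 < #|X|)%N -> (0 < #|Y|)%N -> (0 < m)%N -> 0 < mu ->
  (forall y, avg (fun x => (B y x)%:R) = mu) ->
  avg (fun c : {ffun 'I_k -> {ffun 'I_m -> X}} =>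
    (~~ [exists y, forall j, exists i, B y (c j i)])%:R) <=
  avg (fun y => avg (fun y' =>
    (1 + avg (fun x => (B y x && B y' x)%:R) / (m%:R * mu ^+ 2)) ^+ k)) - 1.
Proof.
move=> X0 Y0 m0 mu0 Bmu.
have m0R : 0 < m%:R :> R by rewrite ltr0n.
have m0' : (0 < #|'I_m|)%N by rewrite card_ord.
have d0 : (0 < #|{ffun 'I_m -> X}|)%N by rewrite card_ffun expn_gt0 X0.
have c0 : (0 < #|{ffun 'I_k -> {ffun 'I_m -> X}}|)%N.
  by rewrite card_ffun expn_gt0 d0.
pose N y (d : {ffun 'I_m -> X}) : R := avg (fun i => (B y (d i))%:R).
(* Normalized count of the centres, weighted by the choices of one codeword
   per block. *)
pose W (c : {ffun 'I_k -> {ffun 'I_m -> X}}) := avg (fun y => \prod_j N y (c j)).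
have N_ge0 y d : 0 <= N y d by apply: avg_ge0.
have avgN y : avg (N y) = mu.
  rewrite /N exchange_avg -(Bmu y) -[RHS](@avg_cst _ 'I_m)//.
  by apply: eq_avg => i; rewrite (avg_ffun_eval i (fun x => (B y x)%:R)).
have avgW : avg W = mu ^+ k.
  rewrite avg_prod_ffun_exchange -[RHS](@avg_cst _ Y)//.
  by apply: eq_avg => y; rewrite avgN.
have W0 : 0 < avg W by rewrite avgW exprn_gt0.
apply: (@le_trans _ _ (avg (fun c => (W c == 0)%:R))).
  apply: ler_avg => c; rewrite ler_nat; case: existsP => //= noy.
  rewrite lt0b; apply/eqP; rewrite /W /avg big1 ?mul0r// => y _.
  apply/eqP/prodf_eq0; apply/exists_inP; rewrite -[X in is_true X]negbK.
  apply/negP; rewrite negb_exists_in => /forall_inP Ny.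
  case: noy; exists y; apply/forallP => j; apply/existsP.
  apply/existsP; apply: contraR (Ny j isT); rewrite negb_exists => /forallP Bc.
  by rewrite /N /avg big1 ?mul0r// => i _; rewrite (negbTE (Bc i)).
apply: le_trans (second_moment_vanish c0 W0) _; rewrite lerD2r avgW.
rewrite ler_pdivrMr ?exprn_gt0// mulrC -avgZ.
have -> : avg (fun c => W c ^+ 2) =
    avg (fun y => avg (fun y' => avg (fun d => N y d * N y' d) ^+ k)).
  rewrite (eq_avg (fun c => etrans (expr2 (W c)) (avgM _ _))).
  rewrite exchange_avg; apply: eq_avg => y.
  under eq_avg do under eq_avg do rewrite -big_split/=.
  by rewrite (avg_prod_ffun_exchange _ (fun y' d => N y d * N y' d)).
apply: ler_avg => y; rewrite -avgZ; apply: ler_avg => y'.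
rewrite -exprM mulnC exprM -exprMn lerXn2r ?nnegrE//.
- by apply: avg_ge0 => d; rewrite mulr_ge0.
- by rewrite mulr_ge0 ?sqr_ge0// addr_ge0// divr_ge0 ?avg_ge0// mulr_ge0 ?sqr_ge0 ?ltW.
have := @avg_block_product R X m (fun x => (B y x)%:R) (fun x => (B y' x)%:R) X0 m0.
move=> /(_ (fun=> ler0n R _) (fun=> ler0n R _)) /le_trans; apply.
rewrite !Bmu; set nu := avg _; set nu' := avg _.
have -> : nu = nu' by apply: eq_avg => x; rewrite -natrM mulnb.
rewrite le_eqVlt; apply/orP; left; apply/eqP; field.
by rewrite !lt0r_neq0.
Qed.

(** * Volumes of Hamming balls and of their intersections *)

(** With [t = p / (1 - p)] the terms are proportional to the binomial
    distribution of parameter [p].  Consecutive terms have ratio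
    [(n - i) * t / i.+1], so they increase up to [s = truncn (p * n)] and
    decrease from [s.+1] on.  The maximum may be at [s.+1], which exceeds the
    term at [s] by a factor at most [n * t]: hence the factor [1 + n * t]. *)
Lemma binomial_term_le_mode (R : realType) (t p : R) (n w : nat) :
  0 < t -> p * (1 + t) = t -> 'C(n, w)%:R * t ^+ w <=
  (1 + n%:R * t) *
    ('C(n, Num.truncn (p * n%:R))%:R * t ^+ Num.truncn (p * n%:R)).
Proof.
move=> t0 pt; set s := Num.truncn _; pose a i : R := 'C(n, i)%:R * t ^+ i.
have t10 : 0 < 1 + t by lra.
have p0 : 0 < p by have := t0; rewrite -{1}pt pmulr_lgt0.
have a0 i : 0 <= a i by rewrite mulr_ge0// exprn_ge0// ltW.
have aS i : a i.+1 * i.+1%:R = a i * ((n - i)%:R * t).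
  rewrite /a exprS; have /(congr1 (fun x => x%:R : R)) := mul_bin_left n i.
  rewrite !natrM => E; transitivity (i.+1%:R * 'C(n, i.+1)%:R * t * t ^+ i).
    by ring.
  by rewrite E; ring.
have /andP[s1 s2] : s%:R <= p * n%:R < s.+1%:R
  by apply: truncn_itv; rewrite mulr_ge0// ltW.
have as_ge : a s <= (1 + n%:R * t) * a s.
  by rewrite ler_peMl// lerDl mulr_ge0// ltW.
have [ws|sw] := leqP w s.
  apply: le_trans as_ge.
  have down j : (j <= s)%N -> a (s - j)%N <= a s.
    elim: j => [|j IH] js; first by rewrite subn0.
    apply: le_trans (IH (ltnW js)).
    have -> : (s - j = (s - j.+1).+1)%N by lia.
    set i := (s - j.+1)%N; have is_ : (i.+1 <= s)%N by rewrite /i; lia.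
    rewrite -(@ler_pM2r _ i.+1%:R) ?ltr0n// aS ler_wpM2l//.
    have i1 : i.+1%:R <= p * n%:R by apply: le_trans s1; rewrite ler_nat.
    have ni : (i <= n)%N.
      have ii1 : i%:R <= i.+1%:R :> R by rewrite ler_nat.
      rewrite -(ler_nat R); apply: le_trans (le_trans ii1 i1) _.
      rewrite ler_piMl// -(@ler_pM2r _ (1 + t))// pt; lra.
    rewrite natrB//.
    have : i.+1%:R * (1 + t) <= p * n%:R * (1 + t) by rewrite ler_wpM2r// ltW.
    rewrite mulrAC pt -natr1; nra.
  by rewrite -(subKn ws); apply: down; rewrite leq_subr.
have -> : w = (s.+1 + (w - s.+1))%N by rewrite subnKC.
elim: (w - s.+1)%N => [|j IH].
  rewrite addn0 -/(a s.+1) -/(a s).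
  apply: (@le_trans _ _ (a s.+1 * s.+1%:R)); first by rewrite ler_peMr// ler1n.
  rewrite aS mulrC ler_wpM2r//.
  have : (n - s)%:R * t <= n%:R * t by rewrite (ler_wpM2r (ltW t0))// ler_nat leq_subr.
  lra.
apply: le_trans IH; rewrite addnS -/(a _) -/(a (s.+1 + j)%N).
set i := (s.+1 + j)%N.
rewrite -(@ler_pM2r _ i.+1%:R) ?ltr0n// aS ler_wpM2l//.
have [ni|/ltnW ni] := leqP n i; first by rewrite (eqP ni) mul0r.
rewrite natrB//.
have ip : p * n%:R <= i%:R by apply/ltW/(lt_le_trans s2); rewrite ler_nat leq_addr.
have : p * n%:R * (1 + t) <= i%:R * (1 + t) by rewrite ler_wpM2r// ltW.
rewrite mulrAC pt -natr1; nra.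
Qed.

Lemma binomial_mode_lower_bound (R : realType) (t p : R) (n : nat) :
  0 < t -> p * (1 + t) = t -> (1 + t) ^+ n <=
  n.+1%:R * (1 + n%:R * t) *
    ('C(n, Num.truncn (p * n%:R))%:R * t ^+ Num.truncn (p * n%:R)).
Proof.
move=> t0 pt; rewrite exprDn.
under eq_bigr do rewrite expr1n mul1r.
under eq_bigr do rewrite -[_ *+ _]mulr_natl.
set b := (X in _ <= _ * X).
apply: (@le_trans _ _ (\sum_(i < n.+1) (1 + n%:R * t) * b)).
  by apply: ler_sum => i _; exact: binomial_term_le_mode.
by rewrite sumr_const card_ord -[leLHS]mulr_natl mulrA.
Qed.

Lemma prod_expr_hamming (R : comNzRingType) (q n : nat) (u : R) (x y : word q n) :
  \prod_i u ^+ (x i != y i) = u ^+ hamming_dist x y.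
Proof.
by rewrite prodrXr /hamming_dist -sum1_card [in RHS]big_mkcond.
Qed.

Lemma sum_expr_neq (R : comNzRingType) (q : nat) (u : R) (b : 'I_q) :
  \sum_(c : 'I_q) u ^+ (c != b) = 1 + q.-1%:R * u.
Proof.
rewrite (bigD1 b)//= eqxx expr0; congr (_ + _).
rewrite (eq_bigr (fun=> u)) => [|c ->//].
by rewrite sumr_const mulr_natl (cardC1 b) card_ord.
Qed.

(** Both sides are coefficients of [\sum_x 'X^(hamming_dist x y)], which is a
    product over the coordinates and thus equals [(1 + q.-1 * 'X) ^+ n]. *)
Lemma sum_sphere (R : comNzRingType) (q n w : nat) (y : word q n) :
  \sum_x (hamming_dist x y == w)%:R = ('C(n, w) * q.-1 ^ w)%:R :> R.
Proof.
have E : \sum_(x : word q n) 'X^(hamming_dist x y) = (1 + q.-1%:R * 'X) ^+ n :> {poly R}.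
  under eq_bigr do rewrite -prod_expr_hamming.
  rewrite -(bigA_distr_bigA (fun i c => 'X ^+ (c != y i))).
  by under eq_bigr do rewrite sum_expr_neq; rewrite prodr_const card_ord.
have /(congr1 (coefp w)) := E; rewrite /= coef_sum => Ew.
rewrite (eq_bigr (fun x => 'X^(hamming_dist x y)`_w)); last first.
  by move=> x _; rewrite coefXn eq_sym.
rewrite {}Ew exprDn coef_sum.
under eq_bigr do rewrite expr1n mul1r coefMn exprMn -natrX mulr_natl coefMn coefXn.
have [wn|nw] := ltnP w n.+1.
  rewrite (bigD1 (Ordinal wn))//= eqxx big1 ?addr0; last first.
    move=> i; rewrite -val_eqE/= eq_sym => /negbTE ->; by rewrite !mul0rn.
  by rewrite -mulrnA mulnC.
rewrite bin_small// mul0n big1// => i _.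
by rewrite gtn_eqF ?mul0rn// (leq_trans (ltn_ord i)).
Qed.

Lemma hamming_dist_le (q n : nat) (x y : word q n) : (hamming_dist x y <= n)%N.
Proof. by rewrite -[leqRHS]card_ord max_card. Qed.

(** In particular the volume of a ball does not depend on its centre. *)
Lemma sum_ball (R : realType) (q n : nat) (y : word q n) (s : R) :
  \sum_x (x \in hamming_ball y s)%:R =
  \sum_(w < n.+1 | w%:R <= s) ('C(n, w) * q.-1 ^ w)%:R :> R.
Proof.
under [RHS]eq_bigr do rewrite -(sum_sphere R _ y).
rewrite exchange_big/=; apply: eq_bigr => x _.
have xn : (hamming_dist x y < n.+1)%N by rewrite ltnS hamming_dist_le.
rewrite big_mkcond (bigD1 (Ordinal xn))//= eqxx big1 ?addr0.
  by rewrite inE; case: ifP.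
move=> i; rewrite -val_eqE/= eq_sym => /negbTE ->; by case: ifP.
Qed.

(** One coordinate of the weighted sum in [ball_inter_bound]: where the two
    centres differ, the sum drops by the factor [r]. *)
Lemma sum_expr_neq2 (R : realFieldType) (q : nat) (s r : R) (a b : 'I_q) : 0 < s ->
  r * (1 + q.-1%:R * s ^+ 2) = 2 * s + (q%:R - 2) * s ^+ 2 ->
  \sum_(c : 'I_q) s ^+ (c != a) * s ^+ (c != b) =
  (1 + q.-1%:R * s ^+ 2) * r ^+ (a != b).
Proof.
move=> s0 rE; have [->|ab] /= := eqVneq a b.
  rewrite mulr1 -(sum_expr_neq _ b); apply: eq_bigr => c _.
  by rewrite -exprD addnn -mul2n exprM.
rewrite expr1 mulrC rE (bigD1 a)//= (bigD1 b) 1?eq_sym//= !eqxx (eq_sym b) ab/=.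
rewrite (eq_bigr (fun=> s ^+ 2)) => [|c /andP[-> ->]//].
rewrite sumr_const -[_ *+ #|_|]mulr_natl.
have -> : #|[pred i : 'I_q | i != a & i != b]| = (q - 2)%N.
  by rewrite -[q in RHS]card_ord -(cardC (pred2 a b)) card2 ab addKn;
    apply: eq_card => i; rewrite !inE negb_or.
have q2 : (2 <= q)%N.
  by rewrite -[q]card_ord -(cardC (pred2 a b)) card2 ab leq_addr.
rewrite natrB//; ring.
Qed.

(** A point in both balls has [hamming_dist x y + hamming_dist x y' <= 2 * rad],
    so its weight [s] to the power [dist + dist - 2 * rad] is at least 1 when
    [s < 1].  The sum of these weights factors over the coordinates. *)
Lemma ball_inter_bound (R : realType) (q n : nat) (y y' : word q n) (s r rad : R) :
  0 < s -> s < 1 ->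
  r * (1 + q.-1%:R * s ^+ 2) = 2 * s + (q%:R - 2) * s ^+ 2 ->
  \sum_x ((x \in hamming_ball y rad) && (x \in hamming_ball y' rad))%:R <=
  s `^ (- (2 * rad)) * (1 + q.-1%:R * s ^+ 2) ^+ n * r ^+ hamming_dist y y'.
Proof.
move=> s0 s1 rE.
apply: (@le_trans _ _ (\sum_(x : word q n) s `^ (- (2 * rad)) *
    \prod_i (s ^+ (x i != y i) * s ^+ (x i != y' i)))).
  apply: ler_sum => x _; rewrite big_split/= !prod_expr_hamming.
  have [xB|_] /= := boolP (_ && _); last first.
    by rewrite mulr_ge0// ?powR_ge0// mulr_ge0// exprn_ge0// ltW.
  rewrite -exprD -powR_mulrn ?(ltW s0)// -powRD; last by rewrite (gt_eqF s0) implybT.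
  move: xB; rewrite !inE => /andP[xy xy'].
  rewrite -[leLHS](powRr0 s) ger_powR ?s0 ?(ltW s1)// natrD; lra.
rewrite -mulr_sumr -mulrA ler_wpM2l ?powR_ge0//.
rewrite -(bigA_distr_bigA (fun i c => s ^+ (c != y i) * s ^+ (c != y' i))).
under eq_bigr do rewrite (sum_expr_neq2 _ _ s0 rE).
by rewrite big_split/= prod_expr_hamming prodr_const card_ord.
Qed.

(** [q ^ h(p)] is the minimum over [s] of
    [s ^ (- 2 p) * (1 + (q - 1) * s ^ 2)]; this is its value at the minimizer,
    where the second factor is [1 / (1 - p)]. *)
Lemma entropy_powR (R : realType) (q : nat) (p s : R) :
  (2 <= q)%N -> 0 < p -> p < 1 -> 0 < s ->
  s ^+ 2 = p / ((1 - p) * q.-1%:R) ->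
  q%:R `^ entropy q p = s `^ (- (2 * p)) * (1 - p)^-1.
Proof.
move=> q2 p0 p1 s0 sE.
have q0 : 0 < q%:R :> R by rewrite ltr0n ltnW.
have lq : 0 < ln q%:R :> R by rewrite ln_gt0// ltr1n.
have q1 : 0 < q.-1%:R :> R by rewrite ltr0n -subn1 subn_gt0.
have p10 : 0 < 1 - p by lra.
have lnsE : 2 * ln s = ln p - ln (1 - p) - ln q.-1%:R.
  rewrite mulr_natl -lnXn// sE ln_div ?posrE ?mulr_gt0// lnM ?posrE//; lra.
apply: ln_inj; rewrite ?posrE ?powR_gt0 ?mulr_gt0 ?powR_gt0 ?invr_gt0//.
rewrite lnM ?posrE ?powR_gt0 ?invr_gt0// lnV ?posrE// !ln_powR /entropy /logq.
have -> : q%:R - 1 = q.-1%:R :> R by rewrite -subn1 natrB// ltnW.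
have -> : - (2 * p) * ln s = - p * (2 * ln s) by ring.
rewrite lnsE; field; exact: lt0r_neq0.
Qed.

(** Up to polynomial factors a ball of radius [p * n] has [q ^ (h(p) * n)] points,
    and two of them share at most the fraction [r ^ distance] of these.  The
    ratio [r] is below 1 because [1 + (q - 1) s^2 - 2 s - (q - 2) s^2] is
    [(1 - s) ^ 2], and [s < 1] amounts to [p < (q - 1) / q]. *)
Lemma hamming_ball_geometry (R : realType) (q : nat) (p : R) :
  (2 <= q)%N -> 0 < p -> p < (q%:R - 1) / q%:R ->
  exists r A : R, [/\ 0 < r, r < 1, 0 < A &
    forall (n : nat) (y : word q n),
      (q%:R `^ entropy q p) ^+ n <=
        A * n.+1%:R ^+ 2 * \sum_x (x \in hamming_ball y (p * n%:R))%:R /\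
      forall y' : word q n,
        \sum_x ((x \in hamming_ball y (p * n%:R)) &&
                (x \in hamming_ball y' (p * n%:R)))%:R <=
        (q%:R `^ entropy q p) ^+ n * r ^+ hamming_dist y y'].
Proof.
move=> q2 p0 pq.
have q2R : 2 <= q%:R :> R by rewrite ler_nat.
have q0 : 0 < q%:R :> R by lra.
have q1E : q.-1%:R = q%:R - 1 :> R by rewrite -subn1 natrB// ltnW.
have q1 : 1 <= q.-1%:R :> R by rewrite q1E; lra.
have pq' : p * q%:R < q%:R - 1 by rewrite -ltr_pdivlMr.
have p1 : p < 1 by rewrite -(ltr_pM2r q0); lra.
(* [theta] is the ratio of the weights of a wrong and of the right symbol in the
   product measure with error probability [p]. *)
pose theta := p / ((1 - p) * q.-1%:R).
have den0 : 0 < (1 - p) * q.-1%:R by rewrite mulr_gt0; lra.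
have th0 : 0 < theta by rewrite divr_gt0.
have th1 : theta < 1 by rewrite ltr_pdivrMr// mul1r q1E; nra.
pose t := q.-1%:R * theta.
have tE : t = p / (1 - p) by rewrite /t /theta; field; apply/andP; split; lra.
have t0 : 0 < t by rewrite mulr_gt0//; lra.
have pt : p * (1 + t) = t by rewrite tE; field; lra.
have t1E : 1 + t = (1 - p)^-1 by rewrite tE; field; lra.
pose s := Num.sqrt theta.
have s0 : 0 < s by rewrite sqrtr_gt0.
have s2 : s ^+ 2 = theta by rewrite sqr_sqrtr// ltW.
have s1 : s < 1 by rewrite -(@ltr_pXn2r _ 2)// ?nnegrE ?(ltW s0)// s2 expr1n.
have D0 : 0 < 1 + q.-1%:R * s ^+ 2 by rewrite s2 -/t; lra.
pose r := (2 * s + (q%:R - 2) * s ^+ 2) / (1 + q.-1%:R * s ^+ 2).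
have rE : r * (1 + q.-1%:R * s ^+ 2) = 2 * s + (q%:R - 2) * s ^+ 2.
  by rewrite /r mulfVK// lt0r_neq0.
have Q_E : q%:R `^ entropy q p = s `^ (- (2 * p)) * (1 + t).
  by rewrite t1E; apply: entropy_powR.
exists r, ((1 + t) / theta); split.
- rewrite divr_gt0// ltr_wpDr ?mulr_gt0// mulr_ge0 ?sqr_ge0//; lra.
- rewrite /r ltr_pdivrMr// mul1r q1E.
  have : 0 < (1 - s) ^+ 2 by rewrite exprn_gt0//; lra.
  nra.
- by rewrite divr_gt0//; lra.
move=> n y.
have QnE : (q%:R `^ entropy q p) ^+ n = s `^ (- (2 * (p * n%:R))) * (1 + t) ^+ n.
  rewrite Q_E exprMn -(powR_mulrn n (powR_ge0 s _)) -powRrM; congr (_ `^ _ * _); ring.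
split=> [|y']; last first.
  have := ball_inter_bound y y' (p * n%:R) s0 s1 rE.
  by rewrite s2 -/t -QnE.
have pn0 : 0 <= p * n%:R by rewrite mulr_ge0// ltW.
set w := Num.truncn (p * n%:R).
have /andP[w1 w2] : w%:R <= p * n%:R < w.+1%:R by apply: truncn_itv.
have wn : (w < n.+1)%N.
  by rewrite ltnS -(ler_nat R); apply: le_trans w1 _; rewrite ler_piMl// ltW.
have vol : 'C(n, w)%:R * q.-1%:R ^+ w <=
    \sum_(x : word q n) (x \in hamming_ball y (p * n%:R))%:R :> R.
  rewrite sum_ball (bigD1 (Ordinal wn))//= natrM natrX lerDl.
  by rewrite sumr_ge0.
have thpow : theta * s `^ (- (2 * (p * n%:R))) * theta ^+ w <= 1.
  rewrite -{1 2}s2 -!exprM -!powR_mulrn ?(ltW s0)//.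
  rewrite -!powRD ?(gt_eqF s0) ?implybT// -[leRHS](powRr0 s).
  rewrite ger_powR ?s0 ?(ltW s1)//.
  by move: w2; rewrite natrM -natr1; lra.
have sp0 : 0 < s `^ (- (2 * (p * n%:R))) by exact: powR_gt0.
rewrite QnE.
set V := \sum_x _ in vol *; set e := s `^ _ in thpow sp0 *.
have V0 : 0 <= V by rewrite sumr_ge0.
apply: le_trans (ler_wpM2l (ltW sp0) (binomial_mode_lower_bound n t0 pt)) _.
rewrite -/w exprMn.
apply: (@le_trans _ _ (e * (n.+1%:R * ((1 + t) * n.+1%:R) * (V * theta ^+ w)))).
  rewrite (ler_wpM2l (ltW sp0))// ler_pM//.
  - by rewrite mulr_ge0// addr_ge0// mulr_ge0// ltW.
  - by rewrite mulr_ge0// mulr_ge0// exprn_ge0// ltW//; lra.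
  - rewrite ler_wpM2l// -natr1; have : 0 <= n%:R :> R by []. nra.
  - by rewrite mulrA ler_wpM2r// exprn_ge0// ltW.
have -> : (1 + t) / theta * n.+1%:R ^+ 2 * V =
   (n.+1%:R * ((1 + t) * n.+1%:R) * V / theta) * 1 by ring.
have -> : e * (n.+1%:R * ((1 + t) * n.+1%:R) * (V * theta ^+ w)) =
   (n.+1%:R * ((1 + t) * n.+1%:R) * V / theta) * (theta * e * theta ^+ w).
  field; exact: lt0r_neq0.
rewrite ler_wpM2l// divr_ge0 ?(ltW th0)// !mulr_ge0//; lra.
Qed.

(** * The failure probability of the block construction *)

(** For [u <= 1] the power is at most its chord [1 + (2 ^ k - 1) * u], and for
    [u >= 1] it is at most [(2 * u) ^ k]. *)
Lemma exprD1_sub1_le (R : realFieldType) (u : R) (k : nat) :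
  0 <= u -> (1 + u) ^+ k.+1 - 1 <= 2 ^+ k.+1 * (u + u ^+ k.+1).
Proof.
move=> u0; have [u1|/ltW u1] := leP u 1; last first.
  apply: (@le_trans _ _ ((2 * u) ^+ k.+1)).
    apply: (@le_trans _ _ ((1 + u) ^+ k.+1)); first by lra.
    by rewrite lerXn2r ?nnegrE; lra.
  by rewrite exprMn ler_wpM2l ?exprn_ge0// lerDr.
have uk : 0 <= u ^+ k.+1 by rewrite exprn_ge0.
have two i : 1 <= 2 ^+ i :> R by rewrite exprn_ege1// ler1n.
have : (1 + u) ^+ k.+1 <= 1 + (2 ^+ k.+1 - 1) * u.
  elim: {uk} k => [|k IH]; first by rewrite !expr1; lra.
  rewrite exprS; apply: le_trans (ler_wpM2l _ IH) _; first by lra.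
  rewrite (exprS 2 k.+1); have : 0 <= (2 ^+ k.+1 - 1) * (u * (1 - u)).
    by rewrite mulr_ge0 ?mulr_ge0 ?subr_ge0 ?two.
  nra.
by have := two k.+1; nra.
Qed.

Lemma hamming_dist_sym (q n : nat) (x y : word q n) :
  hamming_dist x y = hamming_dist y x.
Proof. by apply: eq_card => i; rewrite !inE eq_sym. Qed.

Lemma avg_expr_hamming (R : realFieldType) (q n : nat) (u : R) (y : word q n) :
  avg (fun x => u ^+ hamming_dist y x) = ((1 + q.-1%:R * u) / q%:R) ^+ n.
Proof.
rewrite (eq_avg (fun x => esym (prod_expr_hamming u y x))).
rewrite (avg_ffun_prod (fun i c => u ^+ (y i != c))).
under eq_bigr => i _.
  rewrite /avg card_ord; under eq_bigr do rewrite eq_sym; rewrite sum_expr_neq.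
  over.
by rewrite prodr_const card_ord.
Qed.

(** The average of [u] over the second centre gives the term [1 / m], since
    the average of [nu y] is [mu ^+ 2] by symmetry of the distance.  For
    [u ^ k] the volume and intersection bounds give a constant times
    [r ^ (k * distance)], whose average is [avg_expr_hamming]. *)
Lemma avg_uncovered_blocks (R : realType) (q n k m : nat) (rad Q A r : R) :
  (0 < q)%N -> (0 < m)%N -> 0 < Q -> 0 < A -> 0 < r ->
  (forall y : word q n, Q ^+ n <=
     A * n.+1%:R ^+ 2 * \sum_x (x \in hamming_ball y rad)%:R) ->
  (forall y y' : word q n,
     \sum_x ((x \in hamming_ball y rad) && (x \in hamming_ball y' rad))%:R <=
     Q ^+ n * r ^+ hamming_dist y y') ->
  avg (fun c : {ffun 'I_k.+1 -> {ffun 'I_m -> word q n}} =>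
    (~~ [exists y, forall j, exists i, c j i \in hamming_ball y rad])%:R) <=
  2 ^+ k.+1 * (m%:R^-1 +
    (A ^+ 2 * n.+1%:R ^+ 4 * q%:R ^+ n / (m%:R * Q ^+ n)) ^+ k.+1 *
    ((1 + q.-1%:R * r ^+ k.+1) / q%:R) ^+ n) :> R.
Proof.
move=> q0 m0 Q0 A0 r0 vol inter.
have qR0 : 0 < q%:R :> R by rewrite ltr0n.
have mR0 : 0 < m%:R :> R by rewrite ltr0n.
have Qn0 : 0 < Q ^+ n by rewrite exprn_gt0.
have qn0 : 0 < q%:R ^+ n :> R by rewrite exprn_gt0.
have cardw : #|{: word q n}|%:R = q%:R ^+ n :> R.
  by rewrite card_ffun !card_ord natrX.
have w0 : (0 < #|{: word q n}|)%N by rewrite -(ltr0n R) cardw.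
pose mu : R := avg (fun x : word q n => (x \in hamming_ball [ffun=> Ordinal q0] rad)%:R).
have muE y : avg (fun x : word q n => (x \in hamming_ball y rad)%:R) = mu.
  by rewrite /mu /avg !sum_ball.
have muvol : Q ^+ n <= A * n.+1%:R ^+ 2 * (mu * q%:R ^+ n).
  apply: le_trans (vol [ffun=> Ordinal q0]) _.
  by rewrite /mu /avg cardw divfK// lt0r_neq0.
have mu0 : 0 < mu.
  have : 0 < A * n.+1%:R ^+ 2 * (mu * q%:R ^+ n) by apply: lt_le_trans muvol.
  rewrite pmulr_rgt0; first by rewrite pmulr_lgt0.
  by rewrite mulr_gt0// exprn_gt0.
have := @avg_no_common_cover R _ _ (fun y x => x \in hamming_ball y rad) k.+1 m mu
  w0 w0 m0 mu0 muE.
move=> /le_trans; apply.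
pose nu (y y' : word q n) : R := avg (fun x =>
  ((x \in hamming_ball y rad) && (x \in hamming_ball y' rad))%:R).
pose u y y' := nu y y' / (m%:R * mu ^+ 2).
have mmu0 : 0 < m%:R * mu ^+ 2 by rewrite mulr_gt0// exprn_gt0.
have nu0 y y' : 0 <= nu y y' by exact: avg_ge0.
have u0 y y' : 0 <= u y y' by rewrite divr_ge0// ltW.
rewrite lerBlDr -[X in _ <= _ + X](@avg_cst _ (word q n) _ w0).
set bound := 2 ^+ _ * _.
rewrite -[bound](@avg_cst _ (word q n) _ w0) -avgD.
apply: ler_avg => y; rewrite -lerBlDr.
rewrite -[X in _ - X](@avg_cst _ (word q n) _ w0) -mulN1r -avgZ -avgD.
apply: (@le_trans _ _ (avg (fun y' => 2 ^+ k.+1 * (u y y' + u y y' ^+ k.+1)))).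
  by apply: ler_avg => y'; rewrite mulN1r; exact: exprD1_sub1_le (u0 y y').
rewrite avgZ ler_wpM2l ?exprn_ge0// avgD lerD//.
  rewrite (eq_avg (fun y' => mulrC (nu y y') _)) avgZ.
  have -> : avg (nu y) = mu ^+ 2.
    rewrite /nu exchange_avg expr2 -[X in _ * X](muE y) -avgZ.
    apply: eq_avg => x; rewrite mulrC -(muE x) -avgZ; apply: eq_avg => y'.
    by rewrite -natrM mulnb !inE (hamming_dist_sym y' x).
  by rewrite invfM mulfVK// expf_neq0// lt0r_neq0.
rewrite -(avg_expr_hamming (r ^+ k.+1) y) -avgZ; apply: ler_avg => y'.
rewrite -exprM mulnC exprM -exprMn lerXn2r ?nnegrE//.
  rewrite mulr_ge0 ?exprn_ge0 ?(ltW r0)// divr_ge0// !mulr_ge0 ?exprn_ge0//; exact: ltW.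
rewrite /u ler_pdivrMr//.
apply: (@le_trans _ _ (Q ^+ n * r ^+ hamming_dist y y' / q%:R ^+ n)).
  by rewrite /nu /avg cardw ler_wpM2r// invr_ge0 ltW.
set rd := r ^+ _; have rd0 : 0 < rd by rewrite exprn_gt0.
have -> : Q ^+ n * rd / q%:R ^+ n =
    (Q ^+ n) ^+ 2 * (rd / (Q ^+ n * q%:R ^+ n)).
  by field; rewrite !lt0r_neq0.
have -> : A ^+ 2 * n.+1%:R ^+ 4 * q%:R ^+ n / (m%:R * Q ^+ n) * rd * (m%:R * mu ^+ 2) =
  (A * n.+1%:R ^+ 2 * (mu * q%:R ^+ n)) ^+ 2 * (rd / (Q ^+ n * q%:R ^+ n)).
  by field; rewrite !lt0r_neq0.
rewrite ler_wpM2r ?divr_ge0 ?(ltW rd0)//; first by rewrite mulr_ge0// ltW.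
by rewrite lerXn2r// nnegrE; [exact: ltW|apply: le_trans muvol; exact: ltW].
Qed.

(** * From random codes to uniform averages *)

(** One message per block in the ball around [y] yields [k] distinct messages
    there, because the blocks are disjoint. *)
Lemma list_decodable_good_blocks (R : realType) (q n M k m : nat) (p L : R)
    (C : 'I_M -> word q n) (e : 'I_k * 'I_m -> 'I_M) (y : word q n) :
  injective e -> L < k%:R ->
  (forall j, exists i, C (e (j, i)) \in hamming_ball y (p * n%:R)) ->
  ~ list_decodable p L C.
Proof.
move=> e_inj Lk cover /(_ y); apply/negP; rewrite -ltNge; apply: lt_le_trans Lk _.
have /choice [f fP] := cover.
rewrite ler_nat -[k in (k <= _)%N]card_ord.
rewrite -(card_imset _ (f := fun j => e (j, f j))); last first.
  by move=> j j' /e_inj [].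
apply: subset_leq_card; apply/fintype.subsetP => _ /imsetP[j _ ->].
by rewrite inE; exact: fP.
Qed.

Local Open Scope classical_set_scope.

(** Any injective selection of messages gives independent uniform words. *)
Lemma random_code_cylinder (R : realType) (d : measure_display)
    (T : measurableType d) (q n M : nat) (P : probability T R)
    (C : T -> 'I_M -> word q n) (S : finType) (e : S -> 'I_M) (c : S -> word q n) :
  random_code P C -> injective e ->
  measurable [set w | forall s, C w (e s) = c s] /\
  P [set w | forall s, C w (e s) = c s] = ((q%:R ^+ n) ^- #|S|)%:E.
Proof.
move=> rc e_inj.
(* Independence wants a set for every message; on [e s] this one is the
   singleton of [c s]. *)
pose A (i : 'I_M) := [set x : word q n | forall s, e s = i -> x = c s].
have Ae s : (fun w => C w (e s)) @^-1` A (e s) = [set w | C w (e s) = c s].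
  apply/seteqP; split => w /=; first by apply.
  by move=> -> s' /e_inj ->.
have E : [set w | forall s, C w (e s) = c s] =
    \bigcap_(i in [set` e @: predT]) ((fun w => C w i) @^-1` A i).
  apply/seteqP; split => [w H i /= _ s <-//|w H s].
  have /H : [set` e @: predT] (e s) by exact: imset_f.
  by apply.
split.
  have -> : [set w | forall s, C w (e s) = c s] =
      \big[setI/setT]_(s : S) [set w | C w (e s) = c s].
    rewrite -bigcap_seq; apply/seteqP; split => [w H s _|w H s]; first exact: H.
    by apply: H; rewrite /= mem_index_enum.
  by apply: bigsetI_measurable => s _; apply: random_code_measurable rc _ _.
rewrite E (random_code_independent rc) big_imset/=; last by move=> ? ? _ _ /e_inj.
under eq_bigr do rewrite Ae (random_code_uniform rc).
rewrite prodEFin; congr (_%:E).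
by rewrite prodr_const exprVn.
Qed.

(** There are finitely many codes, so every event about the code is a finite
    union of cylinders. *)
Lemma random_code_measurable_event (R : realType) (d : measure_display)
    (T : measurableType d) (q n M : nat) (P : probability T R)
    (C : T -> 'I_M -> word q n) (Q : ('I_M -> word q n) -> Prop) :
  random_code P C -> measurable [set w | Q (C w)].
Proof.
move=> rc.
have -> : [set w | Q (C w)] = \big[setU/set0]_(c : {ffun 'I_M -> word q n} | `[< Q c >])
    [set w | forall s, C w (id s) = c s].
  rewrite -bigcup_seq_cond; apply/seteqP; split => w /=.
    move=> QC; exists [ffun m => C w m]; rewrite /= ?mem_index_enum ?andTb.
      apply/asboolP; suff -> : ([ffun m => C w m] : 'I_M -> _) = C w by [].
      by apply/funext => m; rewrite ffunE.
    by move=> s; rewrite ffunE.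
  move=> [c /= /andP[_ /asboolP Qc] Cc]; suff -> : C w = c by [].
  exact/funext.
apply: bigsetU_measurable => c _.
by have [] := random_code_cylinder c rc (@inj_id _).
Qed.

(** Reduces the probability to a uniform average over the contents of [k] blocks
    of [m] messages.  The complementary event is covered by the cylinders of the
    block contents without a common ball, and all cylinders have the same
    probability. *)
Lemma not_list_decodable_prob_ge (R : realType) (d : measure_display)
    (T : measurableType d) (q n M k m : nat) (p L : R) (P : probability T R)
    (C : T -> 'I_M -> word q n) :
  random_code P C -> (k * m <= M)%N -> L < k%:R ->
  ((1 - avg (fun c : {ffun 'I_k -> {ffun 'I_m -> word q n}} =>
    (~~ [exists y, forall j, exists i, c j i \in hamming_ball y (p * n%:R)])%:R))%:E
   <= P [set w | ~ list_decodable p L (C w)])%E.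
Proof.
move=> rc kmM Lk.
set bad := fun c : {ffun _ -> _} => _; set E := [set w | _].
have mE : measurable E.
  exact: (random_code_measurable_event (fun c => ~ list_decodable p L c) rc).
have Scard : #|{: 'I_k * 'I_m}| = (k * m)%N by rewrite card_prod !card_ord.
have SM : (#|{: 'I_k * 'I_m}| <= M)%N by rewrite Scard.
pose e (s : 'I_k * 'I_m) : 'I_M := widen_ord SM (enum_rank s).
have e_inj : injective e.
  by move=> s s' /(congr1 val)/= /val_inj /enum_rank_inj.
pose F (c : {ffun 'I_k -> {ffun 'I_m -> word q n}}) :=
  [set w | forall s : 'I_k * 'I_m, C w (e s) = c s.1 s.2].
have FP c : measurable (F c) /\ P (F c) = ((q%:R ^+ n) ^- (k * m))%:E.
  by have := random_code_cylinder (fun s => c s.1 s.2) rc e_inj; rewrite Scard.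
pose B c := ~~ [exists y, forall j, exists i,
  (c : {ffun 'I_k -> {ffun 'I_m -> word q n}}) j i \in hamming_ball y (p * n%:R)].
have FE : ~` E `<=` \bigcup_(c in [set` B]) F c.
  move=> w Ew; exists [ffun j => [ffun i => C w (e (j, i))]]; last first.
    by move=> [j i]; rewrite !ffunE.
  apply/negP => /existsP[y /forallP cov]; apply: Ew.
  apply: (@list_decodable_good_blocks _ _ _ _ _ _ _ _ _ e y) => // j.
  by have /existsP[i] := cov j; rewrite !ffunE; exists i.
have le1 : (P (~` E) <= (avg bad)%:E)%E.
  have := content_sub_fsum P finite_finset (fun c _ => (FP c).1) (measurableC mE) FE.
  move=> /le_trans; apply.
  rewrite -(bigfs _ (index_enum_uniq _)); last by move=> c _; rewrite mem_index_enum.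
  rewrite (eq_bigr (fun=> ((q%:R ^+ n) ^- (k * m))%:E)); last first.
    by move=> c _; exact: (FP c).2.
  rewrite sumEFin lee_fin /avg mulr_suml big_mkcond/=; apply: ler_sum => c _.
  rewrite /bad -/(B c); case: (B c) => /=; last by rewrite mul0r.
  by rewrite mul1r !card_ffun !card_ord !natrX -!exprM (mulnC k) mulnA.
by rewrite -[E in leRHS]setCK (probability_setC _ (measurableC mE)) EFinB leeB.
Qed.

Local Close Scope classical_set_scope.

(** * Asymptotics *)

(** With [h] of order [b / N], [n.+1 * h <= expR (n.+1 * h)] bounds the
    polynomial by an exponential of rate [b / 4]; the remaining [b / 4] absorbs
    the constants. *)
Lemma poly_expR_eventually_le (R : realType) (K b : R) (N : nat) :
  0 < b -> exists n0 : nat, forall n : nat, (n0 <= n)%N ->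
    K * n.+1%:R ^+ N * expR (- (b * n%:R)) <= expR (- (b / 2 * n%:R)).
Proof.
move=> b0; pose h := b / (4 * N.+1%:R).
have N0 : 0 < N.+1%:R :> R by rewrite ltr0n.
have h0 : 0 < h by rewrite divr_gt0// mulr_gt0.
have hN : h * N%:R <= b / 4.
  rewrite /h invfM mulrA -mulrA ler_piMr//; first by rewrite divr_ge0// ltW.
  by rewrite mulrC ler_pdivrMr// mul1r ler_nat.
pose K' := `|K| * h ^- N * expR (h * N%:R).
exists (Num.truncn (4 * K' / b)).+1 => n n0n.
have n0 : 4 * K' / b <= n%:R.
  apply: ltW; apply: lt_le_trans (_ : (Num.truncn (4 * K' / b)).+1%:R <= _).
    exact: truncnS_gt.
  by rewrite ler_nat.
have K'n : K' <= expR (b / 4 * n%:R).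
  apply: le_trans (_ : b / 4 * n%:R <= _).
    by move: n0; rewrite ler_pdivrMr//; lra.
  by apply: le_trans (expR_ge1Dx _); rewrite lerDr.
have nN : n.+1%:R ^+ N <= h ^- N * expR (h * N%:R * n.+1%:R).
  rewrite mulrC -ler_pdivrMr ?invr_gt0 ?exprn_gt0// invrK -exprMn.
  have -> : h * N%:R * n.+1%:R = N%:R * (n.+1%:R * h) by ring.
  have nh0 : 0 <= n.+1%:R * h by apply: mulr_ge0 => //; exact: ltW.
  rewrite expRM_natl lerXn2r ?nnegrE ?expR_ge0 ?nh0//.
  by apply: le_trans (expR_ge1Dx _); rewrite lerDr.
apply: (@le_trans _ _ (`|K| * (h ^- N * expR (h * N%:R * n.+1%:R)) *
  expR (- (b * n%:R)))).
  rewrite ler_wpM2r ?expR_ge0// (le_trans (ler_wpM2r _ (ler_norm K)))//.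
  by rewrite ler_wpM2l.
have -> : `|K| * (h ^- N * expR (h * N%:R * n.+1%:R)) * expR (- (b * n%:R)) =
    K' * expR (h * N%:R * n%:R - b * n%:R).
  rewrite -natr1 mulrDr mulr1 !expRD /K'; ring.
apply: (le_trans (ler_wpM2r (expR_ge0 _) K'n)); rewrite -expRD ler_expR.
have : h * N%:R * n%:R <= b / 4 * n%:R by rewrite ler_wpM2r.
lra.
Qed.

Lemma block_size_lower_bound (R : realType) (q k : nat) (rate : R) :
  (2 <= q)%N -> 0 < rate -> (0 < k)%N ->
  exists n0 : nat, forall n : nat, (n0 <= n)%N ->
    q%:R `^ (rate * n%:R) <= 2 * k%:R * (num_messages q n rate %/ k)%:R.
Proof.
move=> q2 rate0 k0.
have lq : 0 < ln q%:R :> R by rewrite ln_gt0// ltr1n.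
have qn0 : q%:R != 0 :> R by rewrite pnatr_eq0 -lt0n ltnW.
pose z := rate * ln q%:R; have z0 : 0 < z by rewrite mulr_gt0.
exists (Num.truncn (2 * k%:R / z)).+1 => n n0n.
set X := _ `^ _.
have kX : 2 * k%:R <= X.
  have : 2 * k%:R / z < n%:R.
    apply: lt_le_trans (_ : (Num.truncn (2 * k%:R / z)).+1%:R <= _).
      exact: truncnS_gt.
    by rewrite ler_nat.
  rewrite ltr_pdivrMr// => /ltW/le_trans; apply.
  rewrite /X /powR (negbTE qn0); apply: le_trans (expR_ge1Dx _).
  by rewrite /z; lra.
have XM : X < (num_messages q n rate).+1%:R by exact: truncnS_gt.
set M := num_messages q n rate in XM *.
have : (M.+1 <= k * (M %/ k).+1)%N by rewrite mulnC ltn_ceil.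
rewrite -(ler_nat R) natrM -natr1 -[in X in _ <= X -> _]natr1; nra.
Qed.

(** In [avg_uncovered_blocks] the term [1 / m] decays like
    [q ^ (- rate * n)] and the other one, up to polynomial factors, like
    [expR] of [((k eps - 1) * ln q + (q - 1) * r ^ k) * n], where [k] stands for
    [k.+1].  The two inequalities on [g] make the latter exponent negative. *)
Lemma random_code_not_list_decodable (R : realType) (q : nat) (p eps g r A : R)
    (k : nat) :
  (2 <= q)%N -> 0 < A -> 0 < r -> 0 < 1 - entropy q p - eps ->
  (forall (n : nat) (y : word q n),
      (q%:R `^ entropy q p) ^+ n <=
        A * n.+1%:R ^+ 2 * \sum_x (x \in hamming_ball y (p * n%:R))%:R /\
      forall y' : word q n,
        \sum_x ((x \in hamming_ball y (p * n%:R)) &&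
                (x \in hamming_ball y' (p * n%:R)))%:R <=
        (q%:R `^ entropy q p) ^+ n * r ^+ hamming_dist y y') ->
  k.+1%:R * eps <= 1 - g -> q.-1%:R * r ^+ k.+1 < g * ln q%:R ->
  exists (n0 : nat) (delta : R), 0 < delta /\
    forall n : nat, (n0 <= n)%N ->
    forall (d : measure_display) (T : measurableType d) (P : probability T R)
      (C : T -> 'I_(num_messages q n (1 - entropy q p - eps)) -> word q n) (L : R),
      random_code P C -> L < k.+1%:R ->
      ((1 - expR (- (delta * n%:R)))%:E <=
       P [set w | ~ list_decodable p L (C w)]%classic)%E.
Proof.
move=> q2 A0 r0 rate0 geom keps rg.
set rate := 1 - _ - _ in rate0 *.
have q0 : 0 < q%:R :> R by rewrite ltr0n ltnW.
pose l := ln q%:R : R.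
have l0 : 0 < l by rewrite ln_gt0// ltr1n.
have qE (x : R) : q%:R `^ x = expR (x * l) by rewrite /powR gt_eqF.
have qnE n : q%:R ^+ n = expR (n%:R * l) :> R by rewrite -powR_mulrn ?ltW// qE.
pose a := q.-1%:R * r ^+ k.+1.
have a0 : 0 <= a by rewrite mulr_ge0// exprn_ge0// ltW.
(* The decay rates of the two terms of the bound. *)
pose b := Num.min (rate * l) (g * l - a).
have b0 : 0 < b by rewrite lt_min mulr_gt0//= subr_gt0.
pose K1 := 2 * k.+1%:R : R; pose K2 := (A ^+ 2 * K1) ^+ k.+1.
have K10 : 0 < K1 by rewrite mulr_gt0// ltr0n.
have A20 : 0 < A ^+ 2 by rewrite exprn_gt0.
have K20 : 0 < K2 by rewrite exprn_gt0// mulr_gt0.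
have [n1 asymp] := poly_expR_eventually_le (2 ^+ k.+1 * (K1 + K2)) (4 * k.+1) b0.
have [n2 blocks] := block_size_lower_bound q2 rate0 (ltn0Sn k).
exists (maxn n1 n2), (b / 2); split; first by rewrite divr_gt0.
move=> n; rewrite geq_max => /andP[/asymp {}asymp /blocks {}blocks].
move=> d T P C L rc Lk.
set M := num_messages q n rate in C rc blocks *.
pose m := (M %/ k.+1)%N.
have kmM : (k.+1 * m <= M)%N by rewrite mulnC leq_divM.
apply: le_trans (not_list_decodable_prob_ge p rc kmM Lk).
rewrite lee_fin lerD2l lerN2; apply: le_trans asymp.
have X0 : 0 < q%:R `^ (rate * n%:R) :> R by exact: powR_gt0.
have m0R : 0 < m%:R :> R.
  by have := lt_le_trans X0 blocks; rewrite pmulr_rgt0.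
have m0 : (0 < m)%N by rewrite -(ltr0n R).
have Q0 : 0 < q%:R `^ entropy q p :> R by exact: powR_gt0.
apply: (le_trans (@avg_uncovered_blocks R q n k m (p * n%:R) _ A r
  (ltnW q2) m0 Q0 A0 r0 (fun y => (geom n y).1) (fun y => (geom n y).2))).
rewrite -[leRHS]mulrA -[leRHS]mulrA ler_wpM2l ?exprn_ge0//.
have n0 : 0 <= n%:R :> R by [].
have bn1 : b * n%:R <= rate * l * n%:R by rewrite ler_wpM2r// ge_min lexx.
have bn2 : b * n%:R <= (g * l - a) * n%:R by rewrite ler_wpM2r// ge_min lexx orbT.
have keps' : k.+1%:R * eps * (n%:R * l) <= (1 - g) * (n%:R * l).
  by rewrite ler_wpM2r// mulr_ge0// ltW.
have pn1 : 1 <= n.+1%:R ^+ (4 * k.+1) :> R by rewrite exprn_ege1// ler1n.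
rewrite [X in _ <= X]mulrDl lerD//.
  apply: (@le_trans _ _ (K1 * expR (- (b * n%:R)))); last first.
    by rewrite ler_wpM2l ?(ltW K10)// ler_peMl ?expR_ge0.
  apply: (@le_trans _ _ (K1 * expR (- (rate * l * n%:R)))); last first.
    by rewrite ler_wpM2l ?(ltW K10)// ler_expR lerN2.
  have -> : expR (- (rate * l * n%:R)) = (q%:R `^ (rate * n%:R))^-1.
    by rewrite qE -expRN; congr (expR (- _)); ring.
  by rewrite ler_pdivlMr// mulrC ler_pdivrMr.
set Qn := (q%:R `^ entropy q p) ^+ n.
have QnE : Qn = expR (entropy q p * n%:R * l).
  by rewrite /Qn qE -expRM_natl; congr expR; ring.
have ratio : q%:R ^+ n / (m%:R * Qn) <= K1 * expR (eps * n%:R * l).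
  have Qn0 : 0 < Qn by rewrite exprn_gt0.
  rewrite ler_pdivrMr ?mulr_gt0//.
  have -> : q%:R ^+ n = q%:R `^ (rate * n%:R) * (expR (eps * n%:R * l) * Qn).
    rewrite QnE qE qnE -!expRD; congr expR; rewrite /rate; ring.
  have -> : K1 * expR (eps * n%:R * l) * (m%:R * Qn) =
      K1 * m%:R * (expR (eps * n%:R * l) * Qn) by ring.
  by rewrite ler_wpM2r// mulr_ge0 ?expR_ge0// ltW.
have base : A ^+ 2 * (n.+1%:R ^+ 4 * (q%:R ^+ n / (m%:R * Qn))) <=
    A ^+ 2 * (n.+1%:R ^+ 4 * (K1 * expR (eps * n%:R * l))).
  by rewrite ler_wpM2l ?(ltW A20)// ler_wpM2l ?exprn_ge0.
have ratio0 : 0 <= q%:R ^+ n / (m%:R * Qn).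
  by rewrite divr_ge0 ?exprn_ge0 ?ltW// mulr_gt0// exprn_gt0.
have last_factor : ((1 + q.-1%:R * r ^+ k.+1) / q%:R) ^+ n <= expR (a * n%:R - n%:R * l).
  rewrite expr_div_n expRB -qnE ler_wpM2r ?invr_ge0 ?exprn_ge0 ?(ltW q0)//.
  rewrite expRM_natr lerXn2r ?nnegrE ?expR_ge0 ?expR_ge1Dx//.
  by rewrite addr_ge0.
apply: (@le_trans _ _ ((A ^+ 2 * (n.+1%:R ^+ 4 * (K1 * expR (eps * n%:R * l)))) ^+ k.+1 *
    expR (a * n%:R - n%:R * l))).
  have -> : A ^+ 2 * n.+1%:R ^+ 4 * q%:R ^+ n / (m%:R * Qn) =
      A ^+ 2 * (n.+1%:R ^+ 4 * (q%:R ^+ n / (m%:R * Qn))).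
    by rewrite -[LHS]mulrA -[LHS]mulrA.
  rewrite ler_pM//.
  - by rewrite exprn_ge0// mulr_ge0 ?(ltW A20)// mulr_ge0 ?exprn_ge0.
  - by rewrite exprn_ge0// divr_ge0 ?(ltW q0)// addr_ge0.
  - rewrite lerXn2r// nnegrE.
      by rewrite mulr_ge0 ?(ltW A20)// mulr_ge0 ?exprn_ge0.
    by rewrite mulr_ge0 ?(ltW A20)// mulr_ge0 ?exprn_ge0// mulr_ge0 ?(ltW K10) ?expR_ge0.
have -> : (A ^+ 2 * (n.+1%:R ^+ 4 * (K1 * expR (eps * n%:R * l)))) ^+ k.+1 *
    expR (a * n%:R - n%:R * l) =
  K2 * (n.+1%:R ^+ (4 * k.+1) *
    expR (k.+1%:R * (eps * n%:R * l) + (a * n%:R - n%:R * l))).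
  rewrite [in RHS]expRD expRM_natl exprM /K2 !exprMn; ring.
rewrite ler_wpM2l ?(ltW K20)// ler_wpM2l ?(le_trans _ pn1)// ler_expR.
by move: keps' bn2; lra.
Qed.

(** * The choice of constants *)

Lemma not_list_decodable_lt0 (R : realType) (q n M : nat) (p L : R)
    (C : 'I_M -> word q n) : (0 < q)%N -> L < 0 -> ~ list_decodable p L C.
Proof.
move=> q0 L0 /(_ [ffun=> Ordinal q0]); apply/negP; rewrite -ltNge.
exact: lt_le_trans L0 _.
Qed.

(** [c0] is chosen so that [g = r ^ (1 / (4 eps))].  As [g <= 1 / 2], the number
    [k.+1] is at least [1 / (2 eps) - 1], so [r ^ k.+1 <= g ^ 2 / r]: this gains
    a factor [g] over the target [g * ln q], and [g < r * ln q / q] when [eps] is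
    small. *)
Lemma list_size_choice (R : realType) (q : nat) (r c0 eps g : R) :
  (2 <= q)%N -> 0 < r -> r < 1 -> 0 < eps ->
  c0 = - ln r / 4 -> g = expR (- (c0 / eps)) ->
  eps <= c0 * Num.min 2^-1 (r * ln q%:R / q%:R) ->
  let L := (1 - g) / eps - 1 in
  0 <= L ->
  exists k : nat, [/\ L < k.+1%:R, k.+1%:R * eps <= 1 - g &
    q.-1%:R * r ^+ k.+1 < g * ln q%:R].
Proof.
move=> q2 r0 r1 eps0 c0E gE epsle L L0.
have q0 : 0 < q%:R :> R by rewrite ltr0n ltnW.
have l0 : 0 < ln q%:R :> R by rewrite ln_gt0// ltr1n.
have lnr : ln r < 0 by rewrite ln_lt0// r0.
have c00 : 0 < c0 by rewrite c0E; lra.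
have g0 : 0 < g by rewrite gE expR_gt0.
have geps : g < eps / c0.
  rewrite gE expRN -[ltRHS]invrK ltf_pV2 ?posrE ?expR_gt0 ?invr_gt0 ?divr_gt0//.
  rewrite invf_div; apply: lt_le_trans (expR_ge1Dx _).
  by rewrite ltrDr.
have epsc : eps / c0 <= Num.min 2^-1 (r * ln q%:R / q%:R).
  by rewrite ler_pdivrMr// mulrC.
have [g1 g2] : g < 2^-1 /\ g < r * ln q%:R / q%:R.
  by have := lt_le_trans geps epsc; rewrite lt_min => /andP.
have /andP[k1 k2] := truncn_itv L0; set k := Num.truncn L in k1 k2.
have LE : (L + 1) * eps = 1 - g by rewrite subrK mulfVK// lt0r_neq0.
exists k; split=> //.
  by rewrite -LE -natr1 ler_wpM2r ?(ltW eps0)// lerD2r.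
have rk : r ^+ k.+1 <= r^-1 * g ^+ 2.
  rewrite -powR_mulrn ?(ltW r0)//.
  have -> : r^-1 * g ^+ 2 = r `^ (2^-1 / eps - 1).
    rewrite /powR gt_eqF// mulrBl mul1r expRB lnK ?posrE// mulrC.
    rewrite gE -expRM_natl; congr (expR _ * _); rewrite c0E; field.
    exact: lt0r_neq0.
  rewrite ger_powR ?r0 ?(ltW r1)//; apply: le_trans (ltW k2).
  by rewrite lerD2r ler_wpM2r ?invr_ge0 ?(ltW eps0)//; lra.
have q1q : q.-1%:R <= q%:R :> R by rewrite ler_nat leq_pred.
apply: le_lt_trans (_ : q%:R * (r^-1 * g ^+ 2) < _).
  by rewrite ler_pM// ?exprn_ge0// ltW.
have -> : q%:R * (r^-1 * g ^+ 2) = g * (g * (q%:R / r)) by ring.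
rewrite ltr_pM2l// -ltr_pdivlMr ?divr_gt0// invf_div.
by apply: lt_le_trans g2 _; rewrite le_eqVlt; apply/orP; left; apply/eqP; ring.
Qed.
Theorem theorem2p3 (R : realType) (q : nat) (p : R) :
  (2 <= q)%N -> 0 < p -> p < (q%:R - 1) / q%:R ->
  exists c0 eps0 : R, 0 < c0 /\ 0 < eps0 /\
  forall eps : R, 0 < eps -> eps < 1 - entropy q p ->
  exists (gamma : R) (n0 : nat) (delta : R),
    0 < gamma /\ (eps <= eps0 -> gamma <= expR (- (c0 / eps))) /\ 0 < delta /\
    forall n : nat, (n0 <= n)%N ->
    forall (d : measure_display) (T : measurableType d) (P : probability T R)
      (C : T -> 'I_(num_messages q n (1 - entropy q p - eps)) -> word q n),
      random_code P C ->
      ((1 - expR (- (delta * n%:R)))%:E <=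
       P [set w | ~ list_decodable p ((1 - gamma) / eps - 1) (C w)]%classic)%E.
Proof.
move=> q2 p0 pq.
have [r [A [r0 r1 A0 geom]]] := hamming_ball_geometry q2 p0 pq.
have q0 : 0 < q%:R :> R by rewrite ltr0n ltnW.
have l0 : 0 < ln q%:R :> R by rewrite ln_gt0// ltr1n.
pose c0 := - ln r / 4; pose eps0 := c0 * Num.min 2^-1 (r * ln q%:R / q%:R).
have c00 : 0 < c0 by rewrite divr_gt0// oppr_gt0 ln_lt0// r0.
have eps00 : 0 < eps0.
  by rewrite mulr_gt0// lt_min invr_gt0 ltr0n/= divr_gt0// mulr_gt0.
exists c0, eps0; split=> //; split=> // eps e0 eh.
(* A negative list size fails for every code; this covers large [eps], where
   [gamma = 1] is taken. *)
have trivial (g : R) n d (T : measurableType d) (P : probability T R)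
    (C : T -> 'I_(num_messages q n (1 - entropy q p - eps)) -> word q n) :
    (1 - g) / eps - 1 < 0 ->
    ((1 - expR (- (1 * n%:R)))%:E <=
     P [set w | ~ list_decodable p ((1 - g) / eps - 1) (C w)]%classic)%E.
  move=> L0.
  have -> : [set w | ~ list_decodable p ((1 - g) / eps - 1) (C w)]%classic = setT.
    by apply/seteqP; split => // w _; apply: not_list_decodable_lt0 L0; exact: ltnW.
  by rewrite probability_setT lee_fin gerBl expR_ge0.
have [small|large] := leP eps eps0; last first.
  exists 1, 0, 1; split=> //; split; first by [].
  split=> // n _ d T P C _; apply: trivial.
  by rewrite subrr mul0r sub0r oppr_lt0.
pose g := expR (- (c0 / eps)).
have [L0|L0] := ltP ((1 - g) / eps - 1) 0.
  exists g, 0, 1; split; first exact: expR_gt0.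
  by split=> //; split=> // n _ d T P C _; exact: trivial.
have [k [Lk kg rg]] := list_size_choice q2 r0 r1 e0 erefl erefl small L0.
have rate0 : 0 < 1 - entropy q p - eps by lra.
have [n0 [delta [delta0 bound]]] :=
  random_code_not_list_decodable q2 A0 r0 rate0 geom kg rg.
exists g, n0, delta; split; first exact: expR_gt0.
by split=> //; split=> // n nn0 d T P C rc; exact: bound.
Qed.
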